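(* Let $\mathcal{A}$ be a finite-dimensional vector space over a field $\mathcal{K}$ of characteristic zero, let $\mu:\mathcal{A}\otimes\mathcal{A}\otimes\mathcal{A}\to\mathcal{A}$ be a trilinear mapping and let $\alpha_1,\alpha_2:\mathcal{A}\to\mathcal{A}$ be linear maps. Let $\mu^*:\mathcal{A}^*\to\mathcal{A}^*\otimes\mathcal{A}^*\otimes\mathcal{A}^*$ and $\alpha_i^*:\mathcal{A}^*\to\mathcal{A}^*$ be the dual maps. Then: (1) $(\mathcal{A},\mu,(\alpha_i)_{i=1,2})$ is a partially hom-associative ternary algebra if and only if $(\mathcal{A}^*,\mu^*,(\alpha_i^* )_{i=1,2})$ is a partially hom-coassociative ternary coalgebra. (2) $(\mathcal{A},\mu,(\alpha_i)_{i=1,2})$ is a totally hom-associative ternary algebra if and only if $(\mathcal{A}^*,\mu^*,(\alpha_i^* )_{i=1,2})$ is a totally hom-coassociative ternary coalgebra. (3) $(\mathcal{A},\mu,(\alpha_i)_{i=1,2})$ is a weak totally hom-associative ternary algebra if and only if $(\mathcal{A}^*,\mu^*,(\alpha_i^* )_{i=1,2})$ is a weak totally hom-coassociative ternary coalgebra.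
   Context: Dual maps: $\mathcal{A}^*$ is the dual space, $\langle\xi,x\rangle=\xi(x)$, $\langle\alpha^*(f),x\rangle=\langle f,\alpha(x)\rangle$, and $\langle\mu^*(\xi),x\otimes y\otimes z\rangle=\langle\xi,\mu(x,y,z)\rangle$, where $\langle\xi\otimes\eta\otimes\gamma,x\otimes y\otimes z\rangle=\langle\xi,x\rangle\langle\eta,y\rangle\langle\gamma,z\rangle$ (identifying $(\mathcal{A}^{\otimes 3})^*$ with $(\mathcal{A}^* )^{\otimes 3}$). Algebras: let $B$ be a vector space with a trilinear operation $\mu:B\otimes B\otimes B\to B$ and linear maps $\alpha_1,\alpha_2:B\to B$. For $x_1,\dots,x_5\in B$ put $P_1=\mu(\mu(x_1\otimes x_2\otimes x_3)\otimes\alpha_1(x_4)\otimes\alpha_2(x_5))$, $P_2=\mu(\alpha_1(x_1)\otimes\mu(x_2\otimes x_3\otimes x_4)\otimes\alpha_2(x_5))$, $P_3=\mu(\alpha_1(x_1)\otimes\alpha_2(x_2)\otimes\mu(x_3\otimes x_4\otimes x_5))$. Then $(B,\mu,(\alpha_i)_{i=1,2})$ is a totally hom-associative ternary algebra if $P_1=P_2=P_3$ for all $x_1,\dots,x_5$; a weak totally hom-associative ternary algebra if $P_1=P_3$ for all $x_1,\dots,x_5$; a partially hom-associative ternary algebra if $P_1+P_2+P_3=0$ for all $x_1,\dots,x_5$. Coalgebras: let $C$ be a vector space with linear maps $\Delta:C\to C\otimes C\otimes C$, $\alpha_1,\alpha_2:C\to C$. Then $(C,\Delta,(\alpha_i)_{i=1,2})$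 is a totally hom-coassociative ternary coalgebra if $(\Delta\otimes\alpha_1\otimes\alpha_2)\circ\Delta=(\alpha_1\otimes\Delta\otimes\alpha_2)\circ\Delta=(\alpha_1\otimes\alpha_2\otimes\Delta)\circ\Delta$; a weak totally hom-coassociative ternary coalgebra if $(\Delta\otimes\alpha_1\otimes\alpha_2)\circ\Delta=(\alpha_1\otimes\alpha_2\otimes\Delta)\circ\Delta$; a partially hom-coassociative ternary coalgebra if $(\Delta\otimes\alpha_1\otimes\alpha_2+\alpha_1\otimes\Delta\otimes\alpha_2+\alpha_1\otimes\alpha_2\otimes\Delta)\circ\Delta=0$. *)

(* Defs.v *)
From HB Require Import structures.
From mathcomp Require Import all_boot all_order all_algebra.

Set Implicit Arguments.
Unset Strict Implicit.
Unset Printing Implicit Defensive.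

Import GRing.Theory VectorInternalTheory.

Local Open Scope ring_scope.

(* A tensor of [U] and [V] is encoded by its matrix of coordinates in the
   products of the vectors of the bases underlying [v2r] on [U] and [V].
   Lemmas [tens_bilinear], [tliftE] and [tens_ext] together state that
   [tens : U -> V -> tensor U V] is the universal bilinear map on [U * V]. *)
Definition tensor (K : fieldType) (U V : vectType K) : vectType K :=
  'M[K]_(dim U, dim V).

Definition tens (K : fieldType) (U V : vectType K) (u : U) (v : V) :
  tensor U V := (v2r u)^T *m v2r v.

Notation "u ⊗ v" := (tens u v) (at level 40, left associativity) : ring_scope.

Lemma tensEij (K : fieldType) (U V : vectType K) (u : U) (v : V) i j :
  (u ⊗ v : 'M_(_, _)) i j = v2r u 0 i * v2r v 0 j.
Proof. by rewrite mxE big_ord1 mxE. Qed.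

Lemma tens_bilinear (K : fieldType) (U V : vectType K) :
  bilinear_for *:%R *:%R (@tens K U V).
Proof.
split=> [v a u u'|u a v v'] /=.
  by rewrite /tens !linearP /= mulmxDl -scalemxAl.
by rewrite /tens !linearP.
Qed.

Lemma tensPl (K : fieldType) (U V : vectType K) a (u u' : U) (v : V) :
  (a *: u + u') ⊗ v = a *: (u ⊗ v) + u' ⊗ v.
Proof. exact: (tens_bilinear U V).1. Qed.

Lemma tensPr (K : fieldType) (U V : vectType K) a (u : U) (v v' : V) :
  u ⊗ (a *: v + v') = a *: (u ⊗ v) + u ⊗ v'.
Proof. exact: (tens_bilinear U V).2. Qed.

Definition bvect (K : fieldType) (U : vectType K) (i : 'I_(dim U)) : U :=
  r2v (delta_mx 0 i).

Lemma bvect_sum (K : fieldType) (U : vectType K) (u : U) :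
  u = \sum_i v2r u 0 i *: bvect i.
Proof.
apply: v2r_inj; rewrite linear_sum /= [LHS]row_sum_delta.
by apply: eq_bigr => i _; rewrite linearZ /= r2vK.
Qed.

Lemma linear_bvectE (K : fieldType) (U W : vectType K) (f : U -> W) :
  linear f -> forall u, f u = \sum_i v2r u 0 i *: f (bvect i).
Proof.
move=> lf u; pose F : {linear U -> W} := HB.pack f (GRing.isLinear.Build K U W _ f lf).
rewrite {1}[u]bvect_sum -[f _]/(F _) linear_sum.
by apply: eq_bigr => i _; rewrite linearZ.
Qed.

Section Lift.

Variables (K : fieldType) (U V W : vectType K) (b : U -> V -> W).

Definition tlift_fun (t : tensor U V) : W :=
  \sum_i \sum_j (t : 'M_(_, _)) i j *: b (bvect i) (bvect j).

Fact tlift_fun_linear : linear tlift_fun.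
Proof.
move=> a t t'; rewrite /tlift_fun scaler_sumr -big_split; apply: eq_bigr => i _.
rewrite scaler_sumr -big_split; apply: eq_bigr => j _ /=.
by rewrite !mxE scalerDl scalerA.
Qed.

HB.instance Definition _ :=
  GRing.isLinear.Build K (tensor U V) W _ tlift_fun tlift_fun_linear.

(* For bilinear [b], the linear map induced on the tensor product; only the
   values of [b] on basis vectors are used. *)
Definition tlift : 'Hom(tensor U V, W) := linfun tlift_fun.

End Lift.

Lemma tliftE (K : fieldType) (U V W : vectType K) (b : U -> V -> W) :
  bilinear_for *:%R *:%R b -> forall u v, tlift b (u ⊗ v) = b u v.
Proof.
case=> bl br u v; rewrite lfunE /= /tlift_fun.
rewrite (linear_bvectE (bl v)); apply: eq_bigr => i _.
rewrite (linear_bvectE (br _) v) scaler_sumr.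
by apply: eq_bigr => j _; rewrite tensEij scalerA.
Qed.

Lemma tens_sum (K : fieldType) (U V : vectType K) (t : tensor U V) :
  t = \sum_i \sum_j (t : 'M_(_, _)) i j *: (bvect i ⊗ bvect j).
Proof.
rewrite {1}[t]matrix_sum_delta; apply: eq_bigr => i _; apply: eq_bigr => j _.
by congr (_ *: _); rewrite /tens /bvect !r2vK trmx_delta mul_delta_mx.
Qed.

Lemma tens_ext (K : fieldType) (U V W : vectType K) (f g : 'Hom(tensor U V, W)) :
  (forall u v, f (u ⊗ v) = g (u ⊗ v)) -> f = g.
Proof.
move=> fg; apply/lfunP => t; rewrite [t]tens_sum !linear_sum.
apply: eq_bigr => i _; rewrite !linear_sum.
by apply: eq_bigr => j _; rewrite !linearZ /= fg.
Qed.

Definition tmap (K : fieldType) (U V U' V' : vectType K)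
    (f : 'Hom(U, U')) (g : 'Hom(V, V')) : 'Hom(tensor U V, tensor U' V') :=
  tlift (fun u v => f u ⊗ g v).

Notation "f ⊗ g" := (tmap f g) (at level 40, left associativity) : lfun_scope.

Lemma tmapE (K : fieldType) (U V U' V' : vectType K)
    (f : 'Hom(U, U')) (g : 'Hom(V, V')) u v :
  (f ⊗ g)%VF (u ⊗ v) = f u ⊗ g v.
Proof.
apply: tliftE.
by split=> [v' a x y|u' a x y] /=; rewrite linearP ?tensPl ?tensPr.
Qed.

Definition tassoc (K : fieldType) (U V W : vectType K) :
    'Hom(tensor U (tensor V W), tensor (tensor U V) W) :=
  tlift (fun u => tlift (fun v w => u ⊗ v ⊗ w)).

Lemma tassocE (K : fieldType) (U V W : vectType K) (u : U) (v : V) (w : W) :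
  tassoc U V W (u ⊗ (v ⊗ w)) = u ⊗ v ⊗ w.
Proof.
have inE (u' : U) (v' : V) (w' : W) : tlift (fun v w => u' ⊗ v ⊗ w) (v' ⊗ w') = u' ⊗ v' ⊗ w'.
  apply: (tliftE (b := fun v w => u' ⊗ v ⊗ w)).
  by split=> [w1 a x y|v1 a x y] /=; rewrite ?tensPr ?tensPl ?tensPr.
rewrite tliftE ?inE //; split=> [t a x y|u' a x y] /=; last by rewrite linearP.
have /lfunP/(_ t) : tlift (fun (v : V) (w : W) => (a *: x + y) ⊗ v ⊗ w)
   = a *: tlift (fun (v : V) (w : W) => x ⊗ v ⊗ w) + tlift (fun (v : V) (w : W) => y ⊗ v ⊗ w).
  by apply: tens_ext => v' w'; rewrite add_lfunE scale_lfunE !inE !tensPl.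
by rewrite add_lfunE scale_lfunE.
Qed.

Definition tensor3 (K : fieldType) (V : vectType K) : vectType K :=
  tensor (tensor V V) V.

Definition tensor5 (K : fieldType) (V : vectType K) : vectType K :=
  tensor (tensor (tensor3 V) V) V.

Definition dual (K : fieldType) (V : vectType K) : vectType K := 'Hom(V, K^o).

Lemma dual_sumE (K : fieldType) (V : vectType K) (I : finType)
    (F : I -> dual V) (x : V) : (\sum_i F i) x = \sum_i F i x.
Proof. exact: sum_lfunE. Qed.

Section DualMap.

Variables (K : fieldType) (U V : vectType K) (f : 'Hom(U, V)).

Definition dual_map_fun (xi : dual V) : dual U := (xi \o f)%VF.

Fact dual_map_fun_linear : linear dual_map_fun.
Proof.
by move=> a x y; rewrite /dual_map_fun comp_lfunDl comp_lfunZl.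
Qed.

HB.instance Definition _ :=
  GRing.isLinear.Build K (dual V) (dual U) _ dual_map_fun dual_map_fun_linear.

Definition dual_map : 'Hom(dual V, dual U) := linfun dual_map_fun.

Lemma dual_mapE (xi : dual V) (x : U) : dual_map xi x = xi (f x).
Proof. by rewrite lfunE /= /dual_map_fun comp_lfunE. Qed.

End DualMap.

Section Pairing.

Variables (K : fieldType) (U V : vectType K).

Definition tpair : 'Hom(tensor (dual U) (dual V), dual (tensor U V)) :=
  tlift (fun (xi : dual U) (eta : dual V) =>
    tlift (fun u v => (xi u : K) * (eta v : K) : K^o) : dual (tensor U V)).

Lemma tpairE (xi : dual U) (eta : dual V) u v :
  (tpair (xi ⊗ eta)) (u ⊗ v) = xi u * eta v.
Proof.
have inE (x : dual U) (e : dual V) u' v' :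
    tlift (fun u v => (x u : K) * (e v : K) : K^o) (u' ⊗ v') = x u' * e v'.
  apply: (tliftE (b := fun u v => (x u : K) * (e v : K) : K^o)).
  split=> [w1 a y z|v1 a y z] /=; rewrite linearP.
    by rewrite mulrDl /GRing.scale /= mulrA.
  by rewrite mulrDr /GRing.scale /= mulrCA.
rewrite tliftE ?inE //; split=> [t a x y|u' a x y] /=; apply: tens_ext => v' w';
  rewrite add_lfunE scale_lfunE !inE add_lfunE scale_lfunE /GRing.scale /=.
  by rewrite mulrDl mulrA.
by rewrite mulrDr mulrCA.
Qed.

End Pairing.

Section Coordinate.

Variables (K : fieldType) (U : vectType K) (i : 'I_(dim U)).

Definition bcoord_fun (u : U) : K^o := v2r u 0 i.

Fact bcoord_fun_linear : linear bcoord_fun.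
Proof. by move=> a x y; rewrite /bcoord_fun linearP /= !mxE. Qed.

HB.instance Definition _ :=
  GRing.isLinear.Build K U K^o _ bcoord_fun bcoord_fun_linear.

Definition bcoord : dual U := linfun bcoord_fun.

Lemma bcoordE u : bcoord u = v2r u 0 i.
Proof. exact: lfunE. Qed.

End Coordinate.

Lemma dim_dual (K : fieldType) (U : vectType K) : dim (dual U) = dim U.
Proof. by rewrite /dual /dim /= muln1. Qed.

Lemma dim_tensor (K : fieldType) (U V : vectType K) :
  dim (tensor U V) = (dim U * dim V)%N.
Proof. by []. Qed.

Lemma tpair_ker0 (K : fieldType) (U V : vectType K) : lker (tpair U V) == 0%VS.
Proof.
have surj : limg (tpair U V) = fullv.
  apply/vspaceP => phi; rewrite memvf; apply/memv_imgP.
  exists (\sum_i \sum_j phi (bvect i ⊗ bvect j) *: (bcoord i ⊗ bcoord j)).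
    by rewrite memvf.
  apply: tens_ext => u v.
  rewrite {1}[u ⊗ v]tens_sum !linear_sum /= dual_sumE; apply: eq_bigr => i _.
  rewrite !linear_sum /= dual_sumE; apply: eq_bigr => j _.
  rewrite !linearZ /= scale_lfunE tpairE !bcoordE tensEij.
  by rewrite /GRing.scale /= mulrC.
rewrite -dimv_eq0; have := limg_ker_dim (tpair U V) fullv.
rewrite surj capfv !dimvf dim_dual !dim_tensor !dim_dual.
by move/eqP; rewrite -[X in _ == X]add0n eqn_add2r.
Qed.

Section DualTrilinear.

Variables (K : fieldType) (A : vectType K).

(* The identification of [A^* ⊗ A^* ⊗ A^*] with [(A ⊗ A ⊗ A)^*]. *)
Definition tpair3 : 'Hom(tensor3 (dual A), dual (tensor3 A)) :=
  (tpair (tensor A A) A \o (tpair A A ⊗ \1))%VF.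

Lemma tpair3E (xi eta gam : dual A) (x y z : A) :
  tpair3 (xi ⊗ eta ⊗ gam) (x ⊗ y ⊗ z) = xi x * eta y * gam z.
Proof. by rewrite comp_lfunE tmapE tpairE id_lfunE tpairE. Qed.

Lemma tpair3_ker0 : lker tpair3 == 0%VS.
Proof.
have h : (((tpair A A)^-1 ⊗ \1) \o (tpair A A ⊗ \1) =
          \1 :> 'End(tensor3 (dual A)))%VF.
  apply: tens_ext => t z; rewrite comp_lfunE !tmapE !id_lfunE.
  by rewrite lker0_lfunK ?tpair_ker0.
apply/lker0P => s t; rewrite !comp_lfunE.
move/(lker0P (tpair_ker0 _ _)).
by move/(congr1 ((tpair A A)^-1 ⊗ \1)%VF); rewrite -!comp_lfunE h !id_lfunE.
Qed.

Lemma tpair3K : cancel tpair3 tpair3^-1%VF.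
Proof. exact: lker0_lfunK tpair3_ker0. Qed.

Lemma tpair3VK : cancel tpair3^-1%VF tpair3.
Proof.
move=> phi; apply: limg_lfunVK; suff -> : limg tpair3 = fullv by exact: memvf.
apply/eqP; rewrite eqEdim subvf /= limg_dim_eq; last first.
  by rewrite (eqP tpair3_ker0) capv0.
by rewrite !dimvf dim_dual !dim_tensor !dim_dual.
Qed.

Definition dual_tri (mu : 'Hom(tensor3 A, A)) :
    'Hom(dual A, tensor3 (dual A)) :=
  (tpair3^-1 \o dual_map mu)%VF.

Lemma dual_triE (mu : 'Hom(tensor3 A, A)) (xi : dual A) (x y z : A) :
  tpair3 (dual_tri mu xi) (x ⊗ y ⊗ z) = xi (mu (x ⊗ y ⊗ z)).
Proof. by rewrite [dual_tri mu xi]comp_lfunE tpair3VK dual_mapE. Qed.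

End DualTrilinear.

Section Algebras.

Variables (K : fieldType) (B : vectType K).
Variables (mu : 'Hom(tensor3 B, B)) (alpha1 alpha2 : 'End(B)).

Definition hom_assoc1 (x1 x2 x3 x4 x5 : B) : B :=
  mu (mu (x1 ⊗ x2 ⊗ x3) ⊗ alpha1 x4 ⊗ alpha2 x5).

Definition hom_assoc2 (x1 x2 x3 x4 x5 : B) : B :=
  mu (alpha1 x1 ⊗ mu (x2 ⊗ x3 ⊗ x4) ⊗ alpha2 x5).

Definition hom_assoc3 (x1 x2 x3 x4 x5 : B) : B :=
  mu (alpha1 x1 ⊗ alpha2 x2 ⊗ mu (x3 ⊗ x4 ⊗ x5)).

Definition totally_hom_associative : Prop :=
  forall x1 x2 x3 x4 x5,
    hom_assoc1 x1 x2 x3 x4 x5 = hom_assoc2 x1 x2 x3 x4 x5 /\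
    hom_assoc2 x1 x2 x3 x4 x5 = hom_assoc3 x1 x2 x3 x4 x5.

Definition weak_totally_hom_associative : Prop :=
  forall x1 x2 x3 x4 x5,
    hom_assoc1 x1 x2 x3 x4 x5 = hom_assoc3 x1 x2 x3 x4 x5.

Definition partially_hom_associative : Prop :=
  forall x1 x2 x3 x4 x5,
    hom_assoc1 x1 x2 x3 x4 x5 + hom_assoc2 x1 x2 x3 x4 x5
      + hom_assoc3 x1 x2 x3 x4 x5 = 0.

End Algebras.

Section Coalgebras.

Variables (K : fieldType) (C : vectType K).
Variables (Delta : 'Hom(C, tensor3 C)) (alpha1 alpha2 : 'End(C)).

(* [Delta ⊗ alpha1 ⊗ alpha2], [alpha1 ⊗ Delta ⊗ alpha2] and
   [alpha1 ⊗ alpha2 ⊗ Delta], reassociated to the common codomain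
   [C ⊗ C ⊗ C ⊗ C ⊗ C]. *)
Definition hom_coassoc1 : 'Hom(tensor3 C, tensor5 C) :=
  (Delta ⊗ alpha1 ⊗ alpha2)%VF.

Definition hom_coassoc2 : 'Hom(tensor3 C, tensor5 C) :=
  (((tassoc C C C ⊗ \1) \o tassoc C (tensor C C) C) ⊗ \1
     \o (alpha1 ⊗ Delta ⊗ alpha2))%VF.

Definition hom_coassoc3 : 'Hom(tensor3 C, tensor5 C) :=
  ((tassoc (tensor C C) C C ⊗ \1) \o tassoc (tensor C C) (tensor C C) C
     \o (alpha1 ⊗ alpha2 ⊗ Delta))%VF.

Definition totally_hom_coassociative : Prop :=
  (hom_coassoc1 \o Delta = hom_coassoc2 \o Delta)%VF /\
  (hom_coassoc2 \o Delta = hom_coassoc3 \o Delta)%VF.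

Definition weak_totally_hom_coassociative : Prop :=
  (hom_coassoc1 \o Delta = hom_coassoc3 \o Delta)%VF.

Definition partially_hom_coassociative : Prop :=
  ((hom_coassoc1 + hom_coassoc2 + hom_coassoc3) \o Delta = 0)%VF.

End Coalgebras.

Lemma hom_coassoc2E (K : fieldType) (C : vectType K)
    (Delta : 'Hom(C, tensor3 C)) (alpha1 alpha2 : 'End(C)) x y z a b c :
  Delta y = a ⊗ b ⊗ c ->
  hom_coassoc2 Delta alpha1 alpha2 (x ⊗ y ⊗ z)
    = alpha1 x ⊗ a ⊗ b ⊗ c ⊗ alpha2 z.
Proof.
by move=> Dy; rewrite !(comp_lfunE, tmapE, id_lfunE) Dy !(tassocE, tmapE, id_lfunE).
Qed.

Lemma hom_coassoc3E (K : fieldType) (C : vectType K)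
    (Delta : 'Hom(C, tensor3 C)) (alpha1 alpha2 : 'End(C)) x y z a b c :
  Delta z = a ⊗ b ⊗ c ->
  hom_coassoc3 Delta alpha1 alpha2 (x ⊗ y ⊗ z)
    = alpha1 x ⊗ alpha2 y ⊗ a ⊗ b ⊗ c.
Proof.
by move=> Dz; rewrite !(comp_lfunE, tmapE, id_lfunE) Dz !(tassocE, tmapE, id_lfunE).
Qed.

(* Main.v *)
Require Import Defs.
From mathcomp Require Import all_boot all_order all_algebra.

Set Implicit Arguments.
Unset Strict Implicit.
Unset Printing Implicit Defensive.

Import GRing.Theory.

Local Open Scope ring_scope.

(** Each composite occurring in the coalgebra identities is the transpose of
    the corresponding five-fold product: for every functional [xi] and all
    vectors [x1], ..., [x5],
      << coassoc_i (mu^* xi), x1 ⊗ x2 ⊗ x3 ⊗ x4 ⊗ x5 >> = << xi, P_i >>,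
    where the left-hand side pairs the fifth tensor power of [A^*] with that
    of [A] ([tpair5]).  These are [transpose_coassoc1], [transpose_coassoc2]
    and [transpose_coassoc3].  A linear map out of [A^*] and a five-fold
    product that are transposes of each other determine one another
    ([transpose5_eq]): in one direction because the pairing of tensor powers is
    non-degenerate ([tpair5_inj]) and pure tensors span, in the other because
    functionals separate the vectors of [A] ([dual_separates]).  As
    transposition is additive, an identity among the [P_i] is therefore
    equivalent to the same identity among the composites, which gives the
    three equivalences at once. *)

(** * Linear maps and predicates on tensor powers *)

(** In contrast with [tens_ext], this avoids packaging both sides of an
    equation, as functions of the tensor, into linear maps. *)
Lemma tens_ind (K : fieldType) (U V : vectType K) (P : tensor U V -> Prop) :
  (forall a t t', P t -> P t' -> P (a *: t + t')) ->
  (forall u v, P (u ⊗ v)) -> forall t, P t.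
Proof.
move=> Plin Ppure t.
have P0 : P 0 by rewrite -(addNr (0 ⊗ 0)) -scaleN1r; apply: Plin.
have PD t1 t2 : P t1 -> P t2 -> P (t1 + t2).
  by move=> P1 P2; rewrite -[t1]scale1r; apply: Plin.
rewrite [t]tens_sum; apply: (big_ind P) => // i _; apply: (big_ind P) => // j _.
by rewrite -[_ *: _]addr0; apply: Plin.
Qed.

Lemma tens3_ind (K : fieldType) (V : vectType K) (P : tensor3 V -> Prop) :
  (forall a t t', P t -> P t' -> P (a *: t + t')) ->
  (forall x y z, P (x ⊗ y ⊗ z)) -> forall t, P t.
Proof.
move=> Plin Ppure; apply: tens_ind => // t z.
move: t; apply: (@tens_ind _ _ _ (fun t => P (t ⊗ z))) => // a t t' Pt Pt'.
by rewrite tensPl; apply: Plin.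
Qed.

Lemma tens5_ext (K : fieldType) (V W : vectType K)
    (f g : 'Hom(tensor5 V, W)) :
  (forall x1 x2 x3 x4 x5,
     f (x1 ⊗ x2 ⊗ x3 ⊗ x4 ⊗ x5) = g (x1 ⊗ x2 ⊗ x3 ⊗ x4 ⊗ x5)) -> f = g.
Proof.
move=> fg; apply: tens_ext => s x5; move: s; apply: tens_ind => [a s t|s x4].
  by rewrite tensPl !linearP /= => -> ->.
move: s; apply: tens3_ind => [a s t|//].
by rewrite !tensPl !linearP /= => -> ->.
Qed.

(** Over a field an injective map has a left inverse, and tensoring preserves
    left inverses. *)
Lemma tmap_id_ker0 (K : fieldType) (U U' V : vectType K) (f : 'Hom(U, U')) :
  lker f == 0%VS -> lker (f ⊗ (\1 : 'End(V)))%VF == 0%VS.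
Proof.
move=> f_inj.
have fK : ((f^-1 ⊗ \1) \o (f ⊗ \1) = \1 :> 'End(tensor U V))%VF.
  by apply: tens_ext => u v; rewrite comp_lfunE !tmapE !id_lfunE lker0_lfunK.
apply/lker0P => s t /(congr1 (f^-1 ⊗ (\1 : 'End(V)))%VF).
by rewrite -!comp_lfunE fK !id_lfunE.
Qed.

Lemma dual_separates (K : fieldType) (V : vectType K) (x y : V) :
  (forall xi : dual V, xi x = xi y) -> x = y.
Proof.
move=> xy; rewrite [x]bvect_sum [y]bvect_sum.
by apply: eq_bigr => i _; rewrite -!bcoordE xy.
Qed.

(** * The pairing of fifth tensor powers *)

Section Pairing5.

Variables (K : fieldType) (A : vectType K).

(** The identification of the fifth tensor power of [A^*] with the dual of
    the fifth tensor power of [A]. *)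
Definition tpair5 : 'Hom(tensor5 (dual A), dual (tensor5 A)) :=
  (tpair (tensor (tensor3 A) A) A \o
    ((tpair (tensor3 A) A \o (tpair3 A ⊗ \1)) ⊗ \1))%VF.

(** The first three factors are left as an arbitrary tensor because
    [dual_tri mu xi] is in general not a pure tensor. *)
Lemma tpair5E (t : tensor3 (dual A)) (eta gam : dual A) (s : tensor3 A) x4 x5 :
  tpair5 (t ⊗ eta ⊗ gam) (s ⊗ x4 ⊗ x5) = tpair3 A t s * eta x4 * gam x5.
Proof.
by rewrite comp_lfunE tmapE tpairE comp_lfunE tmapE tpairE !id_lfunE.
Qed.

Lemma tpair5_inj : injective tpair5.
Proof.
move=> s t; rewrite !comp_lfunE => /(lker0P (tpair_ker0 _ _)).
apply/lker0P/tmap_id_ker0/lker0P => {}s {}t; rewrite !comp_lfunE.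
move/(lker0P (tpair_ker0 _ _)); apply/lker0P/tmap_id_ker0; exact: tpair3_ker0.
Qed.

(** * Transposes of five-fold products *)

Definition transpose5 (f : 'Hom(dual A, tensor5 (dual A)))
    (F : A -> A -> A -> A -> A -> A) : Prop :=
  forall xi x1 x2 x3 x4 x5,
    tpair5 (f xi) (x1 ⊗ x2 ⊗ x3 ⊗ x4 ⊗ x5) = xi (F x1 x2 x3 x4 x5).

Lemma transpose5_0 : transpose5 0 (fun _ _ _ _ _ => 0).
Proof. by move=> xi *; rewrite zero_lfunE !linear0 zero_lfunE. Qed.

Lemma transpose5D f g F G : transpose5 f F -> transpose5 g G ->
  transpose5 (f + g) (fun x1 x2 x3 x4 x5 => F x1 x2 x3 x4 x5 + G x1 x2 x3 x4 x5).
Proof.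
by move=> fF gG xi *; rewrite add_lfunE !linearD /= add_lfunE fF gG.
Qed.

Lemma transpose5_eq f g F G : transpose5 f F -> transpose5 g G ->
  (forall x1 x2 x3 x4 x5, F x1 x2 x3 x4 x5 = G x1 x2 x3 x4 x5) <-> f = g.
Proof.
move=> fF gG; split=> [FG|fg x1 x2 x3 x4 x5].
  apply/lfunP => xi; apply: tpair5_inj; apply: tens5_ext => *.
  by rewrite fF gG FG.
by apply: dual_separates => xi; rewrite -fF -gG fg.
Qed.

(** * The coalgebra composites are transposes *)

Variables (mu : 'Hom(tensor3 A, A)) (alpha1 alpha2 : 'End(A)).

Local Notation Delta := (dual_tri mu).
Local Notation beta1 := (dual_map alpha1).
Local Notation beta2 := (dual_map alpha2).

(** On a pure tensor [t] these formulas are the defining properties of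
    [mu^*], [alpha1^*] and [alpha2^*] multiplied together.  They are needed
    for every [t], in order to be applied to [mu^* xi]. *)
Lemma tpair5_coassoc1 (t : tensor3 (dual A)) x1 x2 x3 x4 x5 :
  tpair5 (hom_coassoc1 Delta beta1 beta2 t) (x1 ⊗ x2 ⊗ x3 ⊗ x4 ⊗ x5) =
  tpair3 A t (mu (x1 ⊗ x2 ⊗ x3) ⊗ alpha1 x4 ⊗ alpha2 x5).
Proof.
move: t; apply: tens3_ind => [a s t|xi eta gam].
  by rewrite !linearP /= !add_lfunE !scale_lfunE => -> ->.
by rewrite !tmapE tpair5E dual_triE !dual_mapE tpair3E.
Qed.

Lemma tpair5_coassoc2 (t : tensor3 (dual A)) x1 x2 x3 x4 x5 :
  tpair5 (hom_coassoc2 Delta beta1 beta2 t) (x1 ⊗ x2 ⊗ x3 ⊗ x4 ⊗ x5) =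
  tpair3 A t (alpha1 x1 ⊗ mu (x2 ⊗ x3 ⊗ x4) ⊗ alpha2 x5).
Proof.
move: t; apply: tens3_ind => [a s t|xi eta gam].
  by rewrite !linearP /= !add_lfunE !scale_lfunE => -> ->.
rewrite [hom_coassoc2 _ _ _ _]comp_lfunE !tmapE id_lfunE tpair3E -dual_triE.
(* Reassociation is explicit only on pure tensors; the claim is linear in
   [mu^* eta], which may therefore be taken pure. *)
move: (Delta eta); apply: tens3_ind => [a s t|a b c].
  rewrite tensPr !linearP tensPl !linearP /= !add_lfunE !scale_lfunE => -> ->.
  by rewrite mulrDr mulrDl /GRing.scale /= !mulrA [a * _]mulrC.
rewrite [(_ \o tassoc _ _ _)%VF _]comp_lfunE tassocE tmapE tassocE id_lfunE.
by rewrite tpair5E !tpair3E !dual_mapE !mulrA.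
Qed.

Lemma tpair5_coassoc3 (t : tensor3 (dual A)) x1 x2 x3 x4 x5 :
  tpair5 (hom_coassoc3 Delta beta1 beta2 t) (x1 ⊗ x2 ⊗ x3 ⊗ x4 ⊗ x5) =
  tpair3 A t (alpha1 x1 ⊗ alpha2 x2 ⊗ mu (x3 ⊗ x4 ⊗ x5)).
Proof.
move: t; apply: tens3_ind => [a s t|xi eta gam].
  by rewrite !linearP /= !add_lfunE !scale_lfunE => -> ->.
rewrite [hom_coassoc3 _ _ _ _]comp_lfunE !tmapE tpair3E -dual_triE.
move: (Delta gam); apply: tens3_ind => [a s t|a b c].
  rewrite tensPr !linearP /= !add_lfunE !scale_lfunE => -> ->.
  by rewrite mulrDr /GRing.scale /= mulrCA.
rewrite [(_ \o tassoc _ _ _)%VF _]comp_lfunE tassocE tmapE tassocE id_lfunE.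
by rewrite tpair5E !tpair3E !dual_mapE !mulrA.
Qed.

Lemma transpose_coassoc1 :
  transpose5 (hom_coassoc1 Delta beta1 beta2 \o Delta)%VF
    (hom_assoc1 mu alpha1 alpha2).
Proof. by move=> xi *; rewrite comp_lfunE tpair5_coassoc1 dual_triE. Qed.

Lemma transpose_coassoc2 :
  transpose5 (hom_coassoc2 Delta beta1 beta2 \o Delta)%VF
    (hom_assoc2 mu alpha1 alpha2).
Proof. by move=> xi *; rewrite comp_lfunE tpair5_coassoc2 dual_triE. Qed.

Lemma transpose_coassoc3 :
  transpose5 (hom_coassoc3 Delta beta1 beta2 \o Delta)%VF
    (hom_assoc3 mu alpha1 alpha2).
Proof. by move=> xi *; rewrite comp_lfunE tpair5_coassoc3 dual_triE. Qed.

End Pairing5.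

(** * Duality of ternary hom-algebras and hom-coalgebras *)

Theorem theorem2p8 (K : fieldType) (charK0 : [pchar K] =i pred0)
    (A : vectType K) (mu : 'Hom(tensor3 A, A)) (alpha1 alpha2 : 'End(A)) :
  [/\ partially_hom_associative mu alpha1 alpha2 <->
        partially_hom_coassociative (dual_tri mu)
          (dual_map alpha1) (dual_map alpha2),
      totally_hom_associative mu alpha1 alpha2 <->
        totally_hom_coassociative (dual_tri mu)
          (dual_map alpha1) (dual_map alpha2)
    & weak_totally_hom_associative mu alpha1 alpha2 <->
        weak_totally_hom_coassociative (dual_tri mu)
          (dual_map alpha1) (dual_map alpha2)].
Proof.
have T1 := transpose_coassoc1 mu alpha1 alpha2.
have T2 := transpose_coassoc2 mu alpha1 alpha2.
have T3 := transpose_coassoc3 mu alpha1 alpha2.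
split; last exact: transpose5_eq T1 T3.
  rewrite /partially_hom_coassociative !comp_lfunDl.
  exact: transpose5_eq (transpose5D (transpose5D T1 T2) T3) (@transpose5_0 K A).
have [P12 Q12] := transpose5_eq T1 T2; have [P23 Q23] := transpose5_eq T2 T3.
split=> [assoc|[/Q12 E12 /Q23 E23] x1 x2 x3 x4 x5]; last by rewrite E12 E23.
by split; [apply: P12 | apply: P23] => x1 x2 x3 x4 x5;
  case: (assoc x1 x2 x3 x4 x5).
Qed.
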